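(* Consider $n$ agents on a directed graph $\mathcal{G}=([n],\mathcal{E})$ who update their beliefs by the gossips-without-recall updates, i.e. $\boldsymbol{\mu}_{i,0}(\hat\theta)=\dfrac{\nu(\hat\theta)\,\ell_i(\mathbf{s}_{i,0}\mid\hat\theta)}{\sum_{\tilde\theta\in\Theta}\nu(\tilde\theta)\,\ell_i(\mathbf{s}_{i,0}\mid\tilde\theta)}$ and, for all $t\geq 1$, $i\in[n]$, $\hat\theta\in\Theta$, $$\boldsymbol{\mu}_{i,t}(\hat\theta)=\frac{\boldsymbol{\mu}_{\boldsymbol{\sigma}_{t,i},\,t-1}(\hat\theta)\,\ell_i(\mathbf{s}_{i,t}\mid\hat\theta)}{\sum_{\tilde\theta\in\Theta}\boldsymbol{\mu}_{\boldsymbol{\sigma}_{t,i},\,t-1}(\tilde\theta)\,\ell_i(\mathbf{s}_{i,t}\mid\tilde\theta)},$$ where $\boldsymbol{\sigma}_{t,i}$ is the randomly chosen node whose previous belief agent $i$ uses at time $t$. Let $\theta\in\Theta$ be the true state. Suppose that $\mathcal{G}$ is strongly connected and that $\theta$ is globally identifiable, i.e. for every $\check\theta\in\Theta\setminus\{\theta\}$ there is an agent $m\in[n]$ with $D_{KL}\left(\ell_m(\cdot\mid\theta)\,\|\,\ell_m(\cdot\mid\check\theta)\right)>0$. Then all agents learn the truth asymptotically almost surely: conditionally on the true state being $\theta$, with probability one, for every $i\in[n]$, $\boldsymbol{\mu}_{i,t}(\theta)\to 1$ as $t\to\infty$ (equivalently, $\boldsymbol{\mu}_{i,t}(\cdot)$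 converges to the point mass at $\theta$).
   Context: Setting. $n\in\mathbb{N}$, $[n]=\{1,\dots,n\}$, and $\mathcal{G}=([n],\mathcal{E})$ is a directed graph with $\mathcal{E}\subset[n]\times[n]$. The neighborhood of $i$ is $\mathcal{N}(i)=\{j\in[n]:(j,i)\in\mathcal{E}\}$. States and signals. $\Theta$ is a finite set of states and $\nu$ is a probability measure on $\Theta$ with $\nu(\hat\theta)>0$ for all $\hat\theta\in\Theta$ (the common prior). The true state is a $\Theta$-valued random variable $\boldsymbol{\theta}$ with law $\nu$; its realized value is denoted $\theta$. Each agent $i$ has a finite signal space $\mathcal{S}_i$ and, for each $\hat\theta\in\Theta$, a probability mass function $\ell_i(\cdot\mid\hat\theta)$ on $\mathcal{S}_i$. Conditionally on $\boldsymbol{\theta}=\theta$, the random vectors $(\mathbf{s}_{1,t},\dots,\mathbf{s}_{n,t})$, $t=0,1,2,\dots$, are independent over $t$, and for each $i$ the signals $\mathbf{s}_{i,t}$, $t\ge 0$, are i.i.d. with mass function $\ell_i(\cdot\mid\theta)$. For fixed $t$ the signals may be correlated across agents. Random neighbor choices. $(\boldsymbol{\sigma}_{t})_{t\geq 1}$, $\boldsymbol{\sigma}_t=(\boldsymbol{\sigma}_{t,1},\dots,\boldsymbol{\sigma}_{t,n})$, is an i.i.d. (over $t$) sequence of random vectors, independent of the true state and of all signals, with $\mathbb{P}\{\boldsymbol{\sigma}_{t,i}=j\}=p_{i,j}$, where $P=[p_{i,j}]$ is a row-stochastic $n\times n$ matrix such that $p_{i,j}>0$ for every $j\in\mathcal{N}(i)$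 and $p_{i,j}=0$ for every $j\notin\mathcal{N}(i)\cup\{i\}$ (so $p_{i,i}\ge 0$ is allowed). No aperiodicity of $P$ is assumed. $\boldsymbol{\mu}_{i,t}$ is the belief of agent $i$ at time $t$, a random probability distribution on $\Theta$. $D_{KL}(p\|q)=\sum_s p(s)\log\frac{p(s)}{q(s)}\in[0,+\infty]$ is the Kullback-Leibler divergence, equal to $+\infty$ if $p(s)>0=q(s)$ for some $s$. *)

(* Defs.v *)
From mathcomp Require Import all_boot all_order all_algebra finmap.
From mathcomp Require Import all_classical all_reals all_analysis.
Import Order.TTheory GRing.Theory Num.Theory.
Import numFieldNormedType.Exports.

Set Implicit Arguments.
Unset Strict Implicit.
Unset Printing Implicit Defensive.

Local Open Scope classical_set_scope.
Local Open Scope ring_scope.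

Definition is_pmf (R : realType) (S : finType) (p : S -> R) : Prop :=
  (forall x, 0 <= p x) /\ \sum_x p x = 1.

(* Conventions: 0 log (0 / q) = 0, and p log (p / 0) = +oo when p > 0; no term
   of the sum is -oo. *)
Definition KL (R : realType) (S : finType) (p q : S -> R) : \bar R :=
  (\sum_(x : S) if p x == 0%R then 0
                else if q x == 0%R then +oo
                else (p x * ln (p x / q x))%:E)%E.

Definition row_stochastic (R : realType) (n : nat) (p : 'M[R]_n) : Prop :=
  (forall i j, 0 <= p i j) /\ (forall i, \sum_j p i j = 1).

(* [E j i] is the edge (j, i), so that j is then a neighbor of i. *)
Definition strongly_connected (n : nat) (E : rel 'I_n) : Prop :=
  forall i j, connect E i j.

Definition neighborhood (n : nat) (E : rel 'I_n) (i : 'I_n) : {set 'I_n} :=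
  [set j | E j i]%SET.

Section Probability.
Context {d : measure_display} {T : measurableType d} {R : realType}.
Local Open Scope ereal_scope.

(* Random variables with values in a finite type carrying its discrete
   sigma-algebra. *)
Definition discrete_rv (A : finType) (X : T -> A) : Prop :=
  forall a, measurable (X @^-1` [set a]).

Definition cond_prob (P : probability T R) (B A : set T) : \bar R :=
  P (A `&` B) / P B.

Definition almost_surely_given (P : probability T R) (B A : set T) : Prop :=
  measurable A /\ cond_prob P B A = 1.

(* The sigma-algebra generated by a family of discrete random variables. *)
Definition sigma_rvs (I : Type) (A : I -> finType) (X : forall k, T -> A k) :
    set (set T) :=
  <<s \bigcup_k preimage_set_system setT (X k) setT >>.

(* The set function [mu] is meant to be a probability or a conditional
   probability [cond_prob P B]. *)
Definition mutually_independent (mu : set T -> \bar R) (I : choiceType)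
    (F : I -> set (set T)) : Prop :=
  forall (J : {fset I}) (A : I -> set T),
    (forall k, k \in J -> F k (A k)) ->
    mu (\bigcap_(k in [set` J]) A k) = \prod_(k <- J) mu (A k).

Definition independent (mu : set T -> \bar R) (F G : set (set T)) : Prop :=
  forall A B, F A -> G B -> mu (A `&` B) = mu A * mu B.

End Probability.

Section Beliefs.
Context {R : realType} {Theta : finType} {n : nat} {S : 'I_n -> finType}.
Context {T : Type}.

Definition bayes_update (mu lik : Theta -> R) (th : Theta) : R :=
  mu th * lik th / \sum_(th' : Theta) mu th' * lik th'.

(* Gossips without recall. The neighbor choice [sigma t i] is only used for
   t >= 1, so [sigma 0] is irrelevant. The quotient is 0 when the denominator
   vanishes; this happens only on a null event in the model. *)
Fixpoint belief (nu : Theta -> R) (ell : forall i, Theta -> S i -> R)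
    (s : nat -> forall i, T -> S i) (sigma : nat -> 'I_n -> T -> 'I_n)
    (t : nat) (i : 'I_n) (w : T) : Theta -> R :=
  match t with
  | 0%N => bayes_update nu (fun th => ell i th (s 0%N i w))
  | t'.+1 =>
      bayes_update (belief nu ell s sigma t' (sigma t'.+1 i w) w)
                   (fun th => ell i th (s t'.+1 i w))
  end.

Definition globally_identifiable (ell : forall i, Theta -> S i -> R)
    (th : Theta) : Prop :=
  forall th', th' != th ->
    exists m : 'I_n, (0 < KL (ell m th) (ell m th'))%E.

End Beliefs.

Section Model.
Context {d : measure_display} {T : measurableType d} {R : realType}.
Context {Theta : finType} {n : nat} {S : 'I_n -> finType}.
Local Open Scope ereal_scope.

(* The signals of different agents at the same time may be correlated: only
   their marginal laws are prescribed. *)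
Definition signal_model (P : probability T R) (nu : Theta -> R)
    (ell : forall i, Theta -> S i -> R) (state : T -> Theta)
    (s : nat -> forall i, T -> S i) : Prop :=
  [/\ discrete_rv state,
      (forall t i, discrete_rv (s t i)),
      (forall th, P (state @^-1` [set th]) = (nu th)%:E),
      (forall th t i x,
        cond_prob P (state @^-1` [set th]) (s t i @^-1` [set x])
          = (ell i th x)%:E) &
      (forall th,
        mutually_independent (cond_prob P (state @^-1` [set th]))
          (fun t : nat => sigma_rvs (s t)))].

(* The vectors [sigma t] are indexed by t >= 1. Their coordinates at the same
   time may be correlated. *)
Definition gossip_model (P : probability T R) (p : 'M[R]_n)
    (state : T -> Theta) (s : nat -> forall i, T -> S i)
    (sigma : nat -> 'I_n -> T -> 'I_n) : Prop :=
  [/\ (forall t i, (0 < t)%N -> discrete_rv (sigma t i)),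
      mutually_independent P (fun t : nat => sigma_rvs (sigma t.+1)),
      (forall (t : nat) (v : 'I_n -> 'I_n), (0 < t)%N ->
        P [set w | forall i, sigma t i w = v i]
          = P [set w | forall i, sigma 1%N i w = v i]),
      (forall t i j, (0 < t)%N -> P (sigma t i @^-1` [set j]) = (p i j)%:E) &
      independent P
        <<s \bigcup_(t in [set t | (0 < t)%N]) sigma_rvs (sigma t) >>
        <<s preimage_set_system setT state setT
            `|` \bigcup_t sigma_rvs (s t) >>].

End Model.

(* Main.v *)
(* Fix [a != th]. Following the beliefs backwards along the random neighbor
   choices, X_{t,i} = sqrt (mu_{i,t}(a) / mu_{i,t}(th)) satisfies
   X_{t+1,i} = X_{t,j} * sqrt (l_i(s | a) / l_i(s | th)) with j = sigma_{t+1,i}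
   and s = s_{i,t+1}. Given the state [th], s and j are independent of X_{t,.},
   so that the conditional expectations of X_{t+1,.} are obtained from those of
   X_{t,.} by the matrix diag(rho) P, where rho_i <= 1 is the Bhattacharyya
   coefficient of l_i(. | th) and l_i(. | a). Identifiability makes some rho_m
   smaller than 1, and strong connectivity spreads this loss to all agents, so
   that diag(rho) P contracts a weighted sup norm whether or not P is aperiodic.
   Hence X_{t,i} decays geometrically in mean, and almost surely tends to 0 by
   Borel-Cantelli. *)
Require Import Defs.
From mathcomp Require Import all_boot all_order all_algebra finmap.
From mathcomp Require Import all_classical all_reals all_analysis.
From mathcomp Require Import ring lra.
Import Order.TTheory GRing.Theory Num.Theory.
Import numFieldNormedType.Exports.

Set Implicit Arguments.
Unset Strict Implicit.
Unset Printing Implicit Defensive.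

Local Open Scope classical_set_scope.
Local Open Scope ring_scope.

(** * Bhattacharyya coefficients of probability mass functions *)

Section Bhattacharyya.
Context {R : realType} {S : finType}.
Implicit Types p q : S -> R.

Definition bhattacharyya p q : R := \sum_x Num.sqrt (p x * q x).

(** Expanding the square of the Hellinger distance. Its nonnegativity gives a coefficient of at most
    1, and its vanishing forces [p] and [q] to agree everywhere. *)
Lemma sum_sqr_sqrtB p q : is_pmf p -> is_pmf q ->
  \sum_x (Num.sqrt (p x) - Num.sqrt (q x)) ^+ 2 = 2 - 2 * bhattacharyya p q.
Proof.
move=> [p0 p1] [q0 q1].
have -> : 2 - 2 * bhattacharyya p q =
    \sum_x p x + \sum_x q x - \sum_x 2 * Num.sqrt (p x * q x) :> R.
  by rewrite p1 q1 -mulr_sumr.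
rewrite -big_split -sumrB; apply: eq_bigr => x _ /=.
by rewrite sqrrB !sqr_sqrtr// sqrtrM// mulr_natl addrAC.
Qed.

Lemma bhattacharyya_ge0 p q : 0 <= bhattacharyya p q.
Proof. by apply: sumr_ge0 => x _; exact: sqrtr_ge0. Qed.

Lemma bhattacharyya_le1 p q : is_pmf p -> is_pmf q -> bhattacharyya p q <= 1.
Proof.
move=> hp hq; have : 0 <= 2 - 2 * bhattacharyya p q.
  by rewrite -sum_sqr_sqrtB//; apply: sumr_ge0 => x _; exact: sqr_ge0.
by lra.
Qed.

Lemma bhattacharyya_lt1 p q x : is_pmf p -> is_pmf q -> p x != q x ->
  bhattacharyya p q < 1.
Proof.
move=> hp hq pq; rewrite lt_neqAle bhattacharyya_le1// andbT.
apply: contra_neq pq => bc1; have := sum_sqr_sqrtB hp hq.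
rewrite bc1 mulr1 subrr => /psumr_eq0P-/(_ (fun _ _ => sqr_ge0 _))-/(_ x isT).
move=> /eqP; rewrite sqrf_eq0 subr_eq0 eqr_sqrt => [/eqP//||].
  by have [->] := hp.
by have [->] := hq.
Qed.

Lemma KL_gt0_neq p q : (0 < KL p q)%E -> exists x, p x != q x.
Proof.
apply: contraPP => /forallNP pq; rewrite /KL big1 ?ltxx// => x _.
have /negP := pq x; rewrite negbK => /eqP ->.
by case: eqVneq => // qx; rewrite divff// ln1 mulr0.
Qed.

(** The left side is the mean of the square root likelihood ratio when signals follow [p]. Where
    [p x = 0], both terms vanish, so the default value of the quotient is harmless. *)
Lemma sum_sqrt_ratio p q : (forall x, 0 <= p x) -> (forall x, 0 <= q x) ->
  \sum_x Num.sqrt (q x / p x) * p x = bhattacharyya p q.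
Proof.
move=> p0 q0; apply: eq_bigr => x _.
have [->|px] := eqVneq (p x) 0; first by rewrite mulr0 mul0r sqrtr0.
rewrite -[X in _ * X]sqr_sqrtr// sqrtrM// sqrtrV// sqrtrM// expr2 mulrA.
by rewrite mulfVK 1?mulrC// sqrtr_eq0 -ltNge lt_neqAle eq_sym px p0.
Qed.

End Bhattacharyya.

(** * A weighted sup norm contracted by diag(rho) P *)

Section Lyapunov.
Context {R : realType} {n : nat}.
Variables (p : 'M[R]_n) (rho : 'I_n -> R).

(** The [t]-th iterate of diag(rho) P on the constant 1: the mean product of [rho] over the first
    [t] positions of the walk with transition matrix [p] started at [i]. *)
Fixpoint decay (t : nat) (i : 'I_n) : R :=
  if t is t'.+1 then rho i * \sum_j p i j * decay t' j else 1.

Hypotheses (p_stochastic : row_stochastic p) (rho_ge0 : forall i, 0 <= rho i)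
  (rho_le1 : forall i, rho i <= 1).

Let p_ge0 i j : 0 <= p i j. Proof. by have [+ _] := p_stochastic; apply. Qed.

Let p_sum1 i : \sum_j p i j = 1.
Proof. by have [_ +] := p_stochastic; apply. Qed.

Lemma decayS t i : decay t.+1 i = rho i * \sum_j p i j * decay t j.
Proof. by []. Qed.

Lemma decay_ge0 t i : 0 <= decay t i.
Proof.
elim: t i => [|t IH] i /=; first exact: ler01.
by rewrite mulr_ge0// sumr_ge0// => j _; rewrite mulr_ge0.
Qed.

Lemma decayS_le t i : decay t.+1 i <= decay t i.
Proof.
elim: t i => [|t IH] i.
  rewrite /=; under eq_bigr do rewrite mulr1.
  by rewrite p_sum1 mulr1.
rewrite {1}decayS [leRHS]decayS ler_wpM2l// ler_sum// => j _.
by rewrite ler_wpM2l.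
Qed.

Lemma decay_le t t' i : (t <= t')%N -> decay t' i <= decay t i.
Proof.
elim: t' => [|t' IH]; first by rewrite leqn0 => /eqP ->.
by rewrite leq_eqVlt => /predU1P[->//|/IH]; apply: le_trans; exact: decayS_le.
Qed.

(** In the average over neighbors all terms are at most 1, and the one at [j] is smaller and has
    positive weight. *)
Lemma decay_edge_lt1 t i j : 0 < p i j -> decay t j < 1 -> decay t.+1 i < 1.
Proof.
move=> pij dj /=; apply: (@le_lt_trans _ _ (\sum_k p i k * decay t k)).
  by rewrite ler_piMl// sumr_ge0// => k _; rewrite mulr_ge0// decay_ge0.
rewrite -(p_sum1 i) (bigD1 j)//= [ltRHS](bigD1 j)//=.
rewrite ltr_leD// ?gtr_pMr// ler_sum// => k _.
by rewrite ler_piMr// (decay_le k (leq0n t)).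
Qed.

(** The loss at [m] spreads along edges to every agent. As [decay] is nonincreasing in time, one
    horizon [N] works for all agents, and no aperiodicity enters. *)
Lemma lyapunov (E : rel 'I_n) (m : 'I_n) :
  (forall i j, E j i -> 0 < p i j) -> strongly_connected E -> rho m < 1 ->
  exists (h : 'I_n -> R) (lam : R), [/\ 0 < lam, lam < 1, forall i, 1 <= h i &
    forall i, rho i * \sum_j p i j * h j <= lam * h i].
Proof.
move=> p_gt0 E_conn rho_m.
have hit i : exists t, decay t i < 1.
  (* An edge from [k] to [j] gives [p j k] a positive value, so a path leaving [m] is followed
     forwards, with one more unit of time per edge. *)
  have /connectP[l + ->] := E_conn m i.
  have : exists t, decay t m < 1.
    by exists 1%N => /=; under eq_bigr do rewrite mulr1; rewrite p_sum1 mulr1.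
  elim: l m {rho_m} => //= j l IH k [t dt] /andP[Ekj]; apply: IH.
  by exists t.+1; exact: decay_edge_lt1 (p_gt0 _ _ Ekj) dt.
have [k dk] := choice hit.
pose N := \max_i k i.
have dN i : decay N i < 1.
  by apply: le_lt_trans (dk i); apply: decay_le; exact: leq_bigmax.
(* Applying the operator to [h] shifts the sum by one step: it replaces the
   term [decay 0 i = 1] by [decay N i < 1]. *)
pose h i := \sum_(t < N) decay t i.
have h_ge1 i : 1 <= h i.
  rewrite /h; have : (0 < N)%N.
    by rewrite lt0n; apply/eqP => N0; have := dN i; rewrite N0 /= ltxx.
  case: (N) => // N' _; rewrite big_ord_recl -[leLHS]/(decay 0 i) lerDl.
  by rewrite sumr_ge0// => t _; exact: decay_ge0.
have h_gt0 i : 0 < h i by exact: lt_le_trans (h_ge1 i).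
have h_lt i : rho i * \sum_j p i j * h j < h i.
  have -> : rho i * \sum_j p i j * h j = \sum_(t < N) decay t.+1 i.
    under eq_bigr do rewrite mulr_sumr.
    by rewrite exchange_big mulr_sumr.
  rewrite -(ltrD2l (decay 0 i)).
  have <- : \sum_(t < N.+1) decay t i = decay 0 i + \sum_(t < N) decay t.+1 i.
    by rewrite big_ord_recl.
  by rewrite big_ord_recr /= addrC ltrD2r.
pose f i := (rho i * \sum_j p i j * h j) / h i.
(* The default value [2^-1] of the maximum keeps the rate positive even if all [f i] are 0. *)
exists h, (\big[Num.max/2^-1]_i f i); split => //.
- by apply: lt_le_trans (bigmax_ge_id _ _ _ _); rewrite invr_gt0.
- apply/bigmax_ltP; split => [|i _]; first by rewrite invf_lt1// ltr1n.
  by rewrite /f ltr_pdivrMr// mul1r.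
- by move=> i; rewrite -ler_pdivrMr//; exact: le_bigmax.
Qed.

End Lyapunov.

(** * Events about the future of an independent sequence *)

Section Future.
Context {d : measure_display} {T : measurableType d} {R : realType}.
Implicit Types (mu : set T -> \bar R) (F : nat -> set (set T)).

(** Only finite intersections, not the generated sigma-algebra: mutual independence then gives
    product formulas directly, without a monotone class argument. *)
Definition future F (t : nat) : set (set T) :=
  [set G | exists (J : {fset nat}) (A : nat -> set T),
    [/\ forall k, k \in J -> (t <= k)%N, forall k, k \in J -> F k (A k) &
        G = \bigcap_(k in [set` J]) A k]].

Lemma future_setT F t : future F t setT.
Proof.
by exists fset0, (fun=> setT); split => //; rewrite set_fset0 bigcap_set0.
Qed.

(** All indices of [G] exceed [t], so [D] can be added as a new factor at index [t]. Independence
    over the enlarged and over the original index set then gives the product. *)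
Lemma future_setI mu F t D G : mutually_independent mu F -> F t D ->
  future F t.+1 G -> future F t (D `&` G) /\ mu (D `&` G) = (mu D * mu G)%E.
Proof.
move=> indep FD [J [A [tJ FA ->]]].
have tNJ : t \notin J by apply/negP => /tJ; rewrite ltnn.
pose A' k := if k == t then D else A k.
have A'J k : k \in J -> A' k = A k.
  by rewrite /A' => kJ; case: eqVneq kJ tNJ => // -> ->.
have FA' k : k \in (t |` J)%fset -> F k (A' k).
  rewrite !inE => /predU1P[->|kJ]; first by rewrite /A' eqxx.
  by rewrite A'J//; exact: FA.
have bigA : \bigcap_(k in [set` J]) A k = \bigcap_(k in [set` J]) A' k.
  by apply: eq_bigcapr => k /= kJ; rewrite A'J.
have DE : D `&` \bigcap_(k in [set` J]) A k =
    \bigcap_(k in [set` (t |` J)%fset]) A' k.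
  by rewrite bigcap_fsetU1 {1}/A' eqxx bigA.
split.
  exists (t |` J)%fset, A'; split => // k.
  by rewrite !inE => /predU1P[->//|/tJ/ltnW].
rewrite DE indep// big_fsetU1//= {1}/A' eqxx bigA indep//.
by move=> k kJ; apply: FA'; rewrite !inE kJ orbT.
Qed.

Lemma future_sigma F t G (H : set (set T)) : (forall k, F k `<=` <<s H >>) ->
  future F t G -> <<s H >> G.
Proof.
move=> FH [J [A [_ FA ->]]].
apply: (@fin_bigcap_measurable _ (g_sigma_algebraType H)) => //.
by move=> k /= kJ; apply: FH; exact: FA.
Qed.

Lemma future_measurable F t G : (forall k, F k `<=` measurable) ->
  future F t G -> measurable G.
Proof.
move=> FH [J [A [_ FA ->]]]; apply: fin_bigcap_measurable => //.
by move=> k /= kJ; apply: FH; exact: FA.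
Qed.

Lemma sigma_rvs_preimage (I : Type) (A : I -> finType) (X : forall k, T -> A k)
  (k : I) (Y : set (A k)) : sigma_rvs X (X k @^-1` Y).
Proof.
by apply: sub_sigma_algebra; exists k => //; exists Y => //; rewrite setTI.
Qed.

Lemma measurable_preimage (A : finType) (X : T -> A) (Y : set A) :
  discrete_rv X -> measurable (X @^-1` Y).
Proof.
move=> mX; have -> : X @^-1` Y = \bigcup_(a in Y) X @^-1` [set a].
  by apply/seteqP; split => [w Yw|w [a Ya /= ->//]]; exists (X w).
by apply: fin_bigcup_measurable => // a _; exact: mX.
Qed.

Lemma sigma_rvs_measurable (I : Type) (A : I -> finType)
  (X : forall k, T -> A k) : (forall k, discrete_rv (X k)) ->
  sigma_rvs X `<=` measurable.
Proof.
move=> mX; apply: smallest_sub; first exact: sigma_algebra_measurable.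
by move=> _ [k _] [Y _ <-]; rewrite setTI; exact: measurable_preimage.
Qed.

End Future.

(** * Union bounds and null sets *)

Section FiniteCountableUnions.
Context {d : measure_display} {T : measurableType d} {R : realType}.
Variable P : probability T R.

Lemma prob_le_sum (I : finType) (A : set T) (F : I -> set T) (a : I -> R) :
  measurable A -> (forall x, measurable (F x)) -> A `<=` \bigcup_x F x ->
  (forall x, P (F x) <= (a x)%:E)%E -> (P A <= (\sum_x a x)%:E)%E.
Proof.
move=> mA mF AF PF; pose U := \big[setU/set0]_x F x.
have [mU PU] : measurable U /\ (P U <= (\sum_x a x)%:E)%E.
  rewrite /U; elim/big_rec2 : _ => [|x b V _ [mV PV]].
    by rewrite measure0.
  split; first exact: measurableU.
  rewrite EFinD; apply: le_trans (leeD (PF x) PV); exact: measureU2.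
apply: le_trans PU; apply: le_measure => //; rewrite ?inE// => w /AF[x _ Fx].
by rewrite /U (bigD1 x)//=; left.
Qed.

Lemma negligible_forall (I : countType) (B : set T) (Q : I -> set T) :
  (forall i, P.-negligible (B `&` ~` Q i)) ->
  P.-negligible (B `&` ~` [set w | forall i, Q i w]).
Proof.
move=> PQ; apply: (@negligibleS _ _ _ _
    (\bigcup_k if choice.unpickle k is Some i then B `&` ~` Q i else set0)).
  move=> w [Bw /existsNP[i Qi]]; exists (choice.pickle i) => //=.
  by rewrite choice.pickleK.
by apply: negligible_bigcup => k; case: choice.unpickle => // *; exact: negligible_set0.
Qed.

End FiniteCountableUnions.

(** * Factorization over one time step, given the true state *)

Section Tail.
Context {d : measure_display} {T : measurableType d} {R : realType}.
Context {Theta : finType} {n : nat} {S : 'I_n -> finType}.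
Variables (P : probability T R) (nu : Theta -> R)
  (ell : forall i : 'I_n, Theta -> S i -> R) (p : 'M[R]_n)
  (state : T -> Theta) (s : nat -> forall i : 'I_n, T -> S i)
  (sigma : nat -> 'I_n -> T -> 'I_n) (th : Theta).
Hypotheses (nu_gt0 : 0 < nu th) (signalsP : signal_model P nu ell state s)
  (sigmaP : gossip_model P p state s sigma).

Let B := state @^-1` [set th].

(* Events prescribing the state, the signals at times > t and the neighbor choices
   at times > t: [sigma t.+1] carries the index [t]. *)
Definition state_and_future (t : nat) : set (set T) :=
  [set F | exists G C, [/\ future (fun t => sigma_rvs (s t)) t.+1 G,
     future (fun t => sigma_rvs (sigma t.+1)) t C & F = B `&` G `&` C]].

Lemma measurable_state : measurable B.
Proof. by have [mstate _ _ _ _] := signalsP; exact: mstate. Qed.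

Lemma state_and_future_measurable t F : state_and_future t F -> measurable F.
Proof.
have [_ ms _ _ _] := signalsP; have [msigma _ _ _ _] := sigmaP.
move=> [G [C [fG fC ->]]]; apply: measurableI.
  apply: measurableI measurable_state _.
  by apply: future_measurable fG => k; apply: sigma_rvs_measurable.
apply: future_measurable fC => k; apply: sigma_rvs_measurable => i.
exact: msigma.
Qed.

Lemma state_and_futureT t : state_and_future t B.
Proof.
by exists setT, setT; rewrite !setIT; split => //; exact: future_setT.
Qed.

(** The choices are independent of the state and signals jointly, so [C] splits off. The rest is the
    definition of conditional probability, with [P B = nu th > 0]. *)
Lemma prob_future t t' G C :
  future (fun t => sigma_rvs (s t)) t G ->
  future (fun t => sigma_rvs (sigma t.+1)) t' C ->
  P (B `&` G `&` C) = (P B * cond_prob P B G * P C)%E.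
Proof.
have [_ _ PB _ _] := signalsP; have [_ _ _ _ indep] := sigmaP.
move=> fG fC; rewrite setIC indep; last 2 first.
- apply: future_sigma fC => k A FA.
  by apply: sub_sigma_algebra; exists k.+1.
- apply: (@measurableI _ (g_sigma_algebraType _)).
    by apply: sub_sigma_algebra; left; exists [set th] => //; rewrite setTI.
  apply: future_sigma fG => k A FA.
  by apply: sub_sigma_algebra; right; exists k.
rewrite muleC; congr (_ * _)%E; rewrite /cond_prob setIC.
by rewrite muleCA divee ?mule1// PB// eqe gt_eqF.
Qed.

Lemma prob_signal t F i y : state_and_future t F ->
  P (F `&` s t i @^-1` [set y]) = ((ell th y)%:E * P F)%E.
Proof.
have [_ _ _ Ps indep] := signalsP.
move=> [G [C [fG fC ->]]].
have [fD PD] := future_setI (indep th)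
  (@sigma_rvs_preimage _ _ _ _ (s t) i [set y]) fG.
rewrite setIAC -(setIA B G) [G `&` _]setIC (prob_future fD fC) (prob_future fG fC).
by rewrite PD Ps -!muleA muleCA.
Qed.

(** One backward step: besides the product formula, the refined event is again of the admissible
    kind, one time unit earlier, as an induction on time requires. *)
Lemma prob_signal_choice t F i j y : state_and_future t.+1 F ->
  state_and_future t (F `&` sigma t.+1 i @^-1` [set j]
                        `&` s t.+1 i @^-1` [set y]) /\
  P (F `&` sigma t.+1 i @^-1` [set j] `&` s t.+1 i @^-1` [set y]) =
    ((p i j * ell th y)%:E * P F)%E.
Proof.
have [_ _ _ Ps indep] := signalsP; have [_ indep' _ Psigma _] := sigmaP.
move=> [G [C [fG fC ->]]].
have [fD PD] := future_setI (indep th)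
  (@sigma_rvs_preimage _ _ _ _ (s t.+1) i [set y]) fG.
have [fD' PD'] := future_setI indep'
  (@sigma_rvs_preimage _ _ _ _ (sigma t.+1) i [set j]) fC.
set DG := _ `&` G in fD PD; set DC := _ `&` C in fD' PD'.
have -> : B `&` G `&` C `&` sigma t.+1 i @^-1` [set j] `&`
    s t.+1 i @^-1` [set y] = B `&` DG `&` DC.
  by rewrite /DG /DC; apply/seteqP; split => w /=; tauto.
split; first by exists DG, DC.
rewrite (prob_future fD fD') (prob_future fG fC) PD PD' Ps Psigma// EFinM.
by rewrite [X in (X * _)%E]muleCA muleACA; congr (_ * _)%E; rewrite muleC.
Qed.

(** * Geometric decay of a multiplicative recursion along random choices *)

Section Iteration.
Variables (g : forall i, S i -> R) (X : nat -> 'I_n -> T -> R) (K lam : R)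
  (h : 'I_n -> R) (rho : 'I_n -> R).
Hypotheses (g_ge0 : forall i y, 0 <= @g i y) (K_ge0 : 0 <= K)
  (lam_ge0 : 0 <= lam) (h_ge1 : forall i, 1 <= h i)
  (ell_ge0 : forall i y, 0 <= @ell i th y) (p_ge0 : forall i j, 0 <= p i j)
  (rho_le1 : forall i, rho i <= 1)
  (rhoE : forall i, \sum_y g y * @ell i th y = rho i)
  (h_lam : forall i, rho i * \sum_j p i j * h j <= lam * h i)
  (mX : forall t i c, measurable [set w | c <= X t i w])
  (X0 : forall i w, X 0%N i w = K * g (s 0%N i w))
  (XS : forall t i w, X t.+1 i w = X t (sigma t.+1 i w) w * g (s t.+1 i w)).

(* A Markov inequality for [X t i]. The induction on [t] unfolds the last step
   first, so that [F] has to absorb conditions on the later times. *)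
Lemma prob_ge_future t i (c : R) F : 0 < c -> state_and_future t F ->
  (P (F `&` [set w | (c <= X t i w)%R]) <=
   (c^-1 * K * lam ^+ t * h i)%:E * P F)%E.
Proof.
have [_ ms _ _ _] := signalsP; have [msigma _ _ _ _] := sigmaP.
elim: t i c F => [|t IH] i c F c_gt0 fF; have mF := state_and_future_measurable fF.
  have -> : P F = (fine (P F))%:E by rewrite fineK// fin_num_measure.
  set q := fine (P F); have q_ge0 : 0 <= q by rewrite fine_ge0.
  apply: (@le_trans _ _ (\sum_y c^-1 * K * (g y * @ell i th y) * q)%:E).
    apply: (@prob_le_sum _ _ _ _ _ _ (fun y => F `&` s 0%N i @^-1` [set y] `&`
        [set w | c <= X 0%N i w])).
    - exact: measurableI.
    - by move=> y; do 2 apply: measurableI => //; exact: ms.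
    - by move=> w [Fw cw]; exists (s 0%N i w).
    (* Markov's inequality value by value: either [c <= K * g y], and the factor [c^-1 * K * g y] is
       at least 1, or the event is empty. *)
    move=> y; have [cy|cy] := leP c (K * g y); last first.
      have -> : F `&` s 0%N i @^-1` [set y] `&` [set w | c <= X 0%N i w] = set0.
        rewrite -subset0 => w [[_ /= sy]]; rewrite X0 sy.
        by move=> /(lt_le_trans cy); rewrite ltxx.
      by rewrite measure0 lee_fin !mulr_ge0// invr_ge0 ltW.
    apply: (@le_trans _ _ (P (F `&` s 0%N i @^-1` [set y]))).
      apply: le_measure => //; rewrite ?inE//.
        by do 2 apply: measurableI => //; exact: ms.
      by apply: measurableI => //; exact: ms.
    rewrite prob_signal// -[P F](@fineK _)// ?fin_num_measure// -EFinM lee_fin.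
    rewrite ler_wpM2r// mulrA ler_peMl// -mulrA mulrC ler_pdivlMr// mul1r.
    by [].
  rewrite -EFinM lee_fin -mulr_suml -mulr_sumr rhoE expr0 mulr1 ler_wpM2r//.
  rewrite ler_wpM2l ?mulr_ge0 ?invr_ge0 ?(ltW c_gt0)//.
  exact: le_trans (rho_le1 i) (h_ge1 i).
have h_ge0 j : 0 <= h j by apply: le_trans (h_ge1 j).
have -> : P F = (fine (P F))%:E by rewrite fineK// fin_num_measure.
set q := fine (P F); have q_ge0 : 0 <= q by rewrite fine_ge0.
(* The event is split by the neighbor and the signal of the last step; [a u] bounds the piece of
   [u]. *)
pose a (u : 'I_n * S i) := c^-1 * K * lam ^+ t * q *
  ((p i u.1 * h u.1) * (g u.2 * ell th u.2)).
apply: (@le_trans _ _ (\sum_u a u)%:E).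
  apply: (@prob_le_sum _ _ _ _ _ _ (fun u => F `&` sigma t.+1 i @^-1` [set u.1] `&`
      s t.+1 i @^-1` [set u.2] `&` [set w | c <= X t.+1 i w])).
  - exact: measurableI.
  - move=> u; apply: measurableI => //; apply: measurableI; last exact: ms.
    by apply: measurableI => //; exact: msigma.
  - by move=> w [Fw cw]; exists (sigma t.+1 i w, s t.+1 i w).
  move=> [j y]; rewrite /a/=; set G := F `&` _ `&` _.
  have [fG PG] := prob_signal_choice j y fF; rewrite -/G in fG PG.
  have mG := state_and_future_measurable fG.
  (* The threshold is about to be divided by [g y]. If [g y = 0], then [X t.+1 i] is 0 on [G] and
     cannot reach [c]. *)
  have [gy|gy] := eqVneq (g y) 0.
    have -> : G `&` [set w | c <= X t.+1 i w] = set0.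
      rewrite -subset0 => w [[_ /= sy]]; rewrite XS sy gy mulr0.
      by move=> /(lt_le_trans c_gt0); rewrite ltxx.
    by rewrite measure0 gy mul0r !mulr0.
  have gy_gt0 : 0 < g y by rewrite lt_neqAle eq_sym gy g_ge0.
  (* On [G] the recursion reads [X t.+1 i = X t j * g y], so the induction hypothesis applies to
     agent [j], threshold [c / g y] and event [G]. *)
  apply: (@le_trans _ _ (P (G `&` [set w | (c / g y <= X t j w)%R]))).
    apply: le_measure; rewrite ?inE; [exact: measurableI|exact: measurableI|].
    move=> w [Gw] /=; rewrite XS; have [[_ /= ->] /= ->] := Gw.
    by move=> cw; split => //; rewrite ler_pdivrMr.
  apply: le_trans (IH j _ _ _ fG) _; first exact: divr_gt0.
  rewrite PG -[P F](@fineK _)// ?fin_num_measure// -/q -!EFinM lee_fin.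
  by rewrite invf_div -!mulrA; lra.
rewrite -EFinM lee_fin /a -mulr_sumr.
(* The sum over pairs factors into a signal mean, [rho i], and a neighbor average of [h]; [h_lam]
   then yields the extra factor [lam]. *)
have -> : \sum_(u : 'I_n * S i) (p i u.1 * h u.1) * (g u.2 * ell th u.2) =
    rho i * \sum_j p i j * h j.
  rewrite -rhoE mulrC big_distrlr/= pair_bigA; exact: eq_bigr.
have := h_lam i; set r := rho i * _ => hr.
rewrite exprSr -!mulrA ler_wpM2l ?invr_ge0 ?(ltW c_gt0)// ler_wpM2l//.
by rewrite ler_wpM2l ?exprn_ge0// mulrC [leRHS]mulrA ler_wpM2r.
Qed.

Hypotheses (lam_lt1 : lam < 1) (X_ge0 : forall t i w, 0 <= X t i w)
  (lam_gt0 : 0 < lam).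

(* Comparing with the threshold [Num.sqrt lam ^+ t], rather than with a fixed
   one, leaves the summable bound [K * h i * Num.sqrt lam ^+ t], so that a single
   application of Borel-Cantelli already gives convergence to [0]. *)
Lemma iteration_cvg0 i :
  P.-negligible (B `&` ~` [set w | X t i w @[t --> \oo] --> (0 : R)]).
Proof.
set r := Num.sqrt lam.
have r_gt0 : 0 < r by rewrite sqrtr_gt0.
have r_lt1 : r < 1 by rewrite -sqrtr1 ltr_sqrt.
pose F t := B `&` [set w | r ^+ t <= X t i w].
have mF t : measurable (F t) by apply: measurableI => //; exact: measurable_state.
have K' : 0 <= K * h i by rewrite mulr_ge0// (le_trans _ (h_ge1 i)).
have PF t : (P (F t) <= (K * h i * r ^+ t)%:E)%E.
  have := prob_ge_future i (exprn_gt0 t r_gt0) (state_and_futureT t).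
  have -> : (r ^+ t)^-1 * K * lam ^+ t * h i = K * h i * r ^+ t.
    rewrite -[lam]sqr_sqrtr// -/r -exprM mulnC exprM.
    by field; rewrite expf_neq0// gt_eqF.
  move/le_trans; apply; rewrite -[leRHS]mule1 lee_wpmul2l//.
    by rewrite lee_fin mulr_ge0// exprn_ge0// ltW.
  by rewrite probability_le1//; exact: measurable_state.
have cvg_geo : cvgn (series (geometric (K * h i) r)).
  by apply: is_cvg_geometric_series; rewrite ger0_norm// ltW.
(* Outside this null set, on [B], eventually [0 <= X t i w <= r ^+ t], which squeezes the sequence
   to 0. *)
exists (lim_sup_set F); split.
- apply: bigcapT_measurable => k; apply: bigcup_measurable => j _; exact: mF.
- apply: lim_sup_set_cvg0 => //.
  apply: (@le_lt_trans _ _ (\sum_(0 <= t <oo) (K * h i * r ^+ t)%:E)%E).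
    by apply: lee_nneseries => // t _; exact: PF.
  rewrite (_ : limn _ = (limn (series (geometric (K * h i) r)))%:E) ?ltry//.
  rewrite -EFin_lim//; apply: congr_lim; apply/funext => k /=.
  by rewrite sumEFin.
move=> w [Bw /= Xw]; apply: contrapT => /existsNP[k /not_implyP[_ Fw]].
apply: Xw; apply: (@squeeze_cvgr _ _ _ _ (fun=> 0) (fun t => 1 * r ^+ t)).
- near=> t; rewrite X_ge0/= mul1r leNgt; apply/negP => rX.
  apply: Fw; exists t; first by near: t; exact: nbhs_infty_ge.
  by split => //=; exact: ltW.
- exact: cvg_cst.
- by apply: cvg_geometric; rewrite ger0_norm// ltW.
Unshelve. all: by end_near. Qed.

End Iteration.

(** Each of the finitely many signals of likelihood 0 under [th] has probability 0 given [th]. Off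
    these null events Bayes denominators do not vanish. *)
Lemma signal_likelihood_gt0 t i : (forall y, 0 <= @ell i th y) ->
  P.-negligible (B `&` ~` [set w | 0 < ell th (s t i w)]).
Proof.
move=> ell_ge0.
apply: (@negligibleS _ _ _ P (B `&` ~` [set w | forall y, s t i w = y ->
    0 < ell th y])).
  by move=> w [Bw /= ell0]; split => // /(_ _ erefl).
apply: negligible_forall => y.
have [ell_y|ell_y] := ltP 0 (ell th y).
  by apply: (negligibleS _ (negligible_set0 P)) => w [_ /=]; apply.
exists (B `&` s t i @^-1` [set y]); split.
- have [_ ms _ _ _] := signalsP.
  by apply: measurableI; [exact: measurable_state|exact: ms].
- rewrite (prob_signal y (state_and_futureT t)).
  have -> : ell th y = 0 by apply/le_anti; rewrite ell_y ell_ge0.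
  by rewrite mul0e.
- by move=> w [Bw /= /not_implyP[sy _]].
Qed.

Lemma almost_surely_negligible (A : set T) : measurable A ->
  P.-negligible (B `&` ~` A) -> almost_surely_given P B A.
Proof.
move=> mA /negligibleP PN; split => //; have mB := measurable_state.
have [_ _ PB _ _] := signalsP.
have {}PN : P (B `&` ~` A) = 0%E.
  by apply: PN; apply: measurableI => //; exact: measurableC.
rewrite /cond_prob setIC; suff -> : P (B `&` A) = P B.
  by rewrite divee// PB// eqe gt_eqF.
by rewrite [RHS](measureDI P mB mA) [X in (X + _)%E](_ : _ = 0%E) ?add0e.
Qed.


End Tail.

(** * Likelihood ratios and positivity of beliefs *)

Section Beliefs.
Context {R : realType} {Theta : finType}.
Implicit Types mu lik : Theta -> R.

Lemma bayes_update_ge0 mu lik a : (forall a, 0 <= mu a) ->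
  (forall a, 0 <= lik a) -> 0 <= bayes_update mu lik a.
Proof.
move=> mu0 lik0; rewrite /bayes_update divr_ge0 ?mulr_ge0// sumr_ge0// => b _.
by rewrite mulr_ge0.
Qed.

(** The normalization cancels. If it is 0, so is [mu b * lik b], and both sides are 0 by the
    convention for division by 0; hence the recursion for ratios holds at every sample point. *)
Lemma bayes_update_ratio mu lik a b : (forall a, 0 <= mu a) ->
  (forall a, 0 <= lik a) ->
  bayes_update mu lik a / bayes_update mu lik b =
  (mu a / mu b) * (lik a / lik b).
Proof.
move=> mu0 lik0; rewrite /bayes_update mulf_div.
set D := \sum_c mu c * lik c.
have [D0|D0] := eqVneq D 0; last by rewrite invf_div mulrA mulfVK.
have : mu b * lik b = 0.
  by apply: (psumr_eq0P _ D0) => // c _; rewrite mulr_ge0.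
by rewrite D0 => ->; rewrite !(invr0, mulr0).
Qed.

Lemma bayes_update_gt0 mu lik a : (forall a, 0 <= mu a) ->
  (forall a, 0 <= lik a) -> 0 < mu a -> 0 < lik a ->
  0 < bayes_update mu lik a /\ \sum_b bayes_update mu lik b = 1.
Proof.
move=> mu0 lik0 mua lika.
have D0 : 0 < \sum_b mu b * lik b.
  rewrite (bigD1 a)//= ltr_wpDr ?mulr_gt0// sumr_ge0// => b _.
  by rewrite mulr_ge0.
split; first by rewrite divr_gt0// mulr_gt0.
by rewrite -mulr_suml divff// gt_eqF.
Qed.

Section Belief.
Context {T : Type} {n : nat} {S : 'I_n -> finType}.
Variables (nu : Theta -> R) (ell : forall i, Theta -> S i -> R)
  (s : nat -> forall i, T -> S i) (sigma : nat -> 'I_n -> T -> 'I_n).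
Hypotheses (nu_ge0 : forall a, 0 <= nu a)
  (ell_ge0 : forall i a y, 0 <= @ell i a y).

Local Notation belief := (belief nu (@ell) s sigma).

Lemma belief_ge0 t i w a : 0 <= belief t i w a.
Proof. by elim: t i a => [|t IH] i a /=; apply: bayes_update_ge0. Qed.

Lemma belief0_ratio i w a b : belief 0 i w a / belief 0 i w b =
  (nu a / nu b) * (ell a (s 0 i w) / ell b (s 0 i w)).
Proof. exact: bayes_update_ratio. Qed.

Lemma beliefS_ratio t i w a b : belief t.+1 i w a / belief t.+1 i w b =
  (belief t (sigma t.+1 i w) w a / belief t (sigma t.+1 i w) w b) *
  (ell a (s t.+1 i w) / ell b (s t.+1 i w)).
Proof. by apply: bayes_update_ratio => // c; exact: belief_ge0. Qed.

Lemma belief_gt0 t i w a : 0 < nu a -> (forall t i, 0 < ell a (s t i w)) ->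
  0 < belief t i w a /\ \sum_b belief t i w b = 1.
Proof.
move=> nu_a ell_a; elim: t i => [|t IH] i /=; apply: bayes_update_gt0 => //.
  by move=> b; exact: belief_ge0.
exact: (IH _).1.
Qed.

End Belief.
End Beliefs.

(** * Measurability of convergence events *)

Section Convergence.
Context {d : measure_display} {T : measurableType d} {R : realType}.

Lemma measurable_cvg_set (f : nat -> T -> R) (l : R) :
  (forall t e, measurable [set w | `|l - f t w| < e]) ->
  measurable [set w | f t w @[t --> \oo] --> l].
Proof.
move=> mf.
have -> : [set w | f t w @[t --> \oo] --> l] =
    \bigcap_k \bigcup_N \bigcap_(t in [set t | (N <= t)%N])
      [set w | `|l - f t w| < k.+1%:R^-1].
  apply/seteqP; split => [w /= fl k _|w fl /=].
    have /cvgrPdist_lt/(_ k.+1%:R^-1) := fl.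
    by rewrite invr_gt0 => /(_ (ltr0Sn _ _))[N _ Nf]; exists N.
  apply/cvgrPdist_lt => e e_gt0.
  have [k _ /(_ k (leqnn k)) /= ke] := near_infty_natSinv_lt (PosNum e_gt0).
  have [N _ Nf] := fl k I; exists N => // t Nt /=.
  exact: lt_trans (Nf t Nt) ke.
apply: bigcapT_measurable => k; apply: bigcup_measurable => N _.
by apply: bigcap_measurableType => t _; exact: mf.
Qed.

End Convergence.

(** * Almost sure learning of the true state *)

Section Learning.
Context {d : measure_display} {T : measurableType d} {R : realType}.
Context {Theta : finType} {n : nat} {S : 'I_n -> finType}.
Variables (P : probability T R) (nu : Theta -> R)
  (ell : forall i : 'I_n, Theta -> S i -> R) (p : 'M[R]_n)
  (state : T -> Theta) (s : nat -> forall i : 'I_n, T -> S i)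
  (sigma : nat -> 'I_n -> T -> 'I_n) (th : Theta).
Hypotheses (nu_gt0 : forall a, 0 < nu a)
  (signalsP : signal_model P nu ell state s)
  (sigmaP : gossip_model P p state s sigma)
  (ell_pmf : forall i a, is_pmf (@ell i a)) (p_stochastic : row_stochastic p).

Local Notation belief := (belief nu ell s sigma).
Let B := state @^-1` [set th].

Let ell_ge0 i a y : 0 <= @ell i a y.
Proof. by have [+ _] := ell_pmf i a; apply. Qed.

(** A belief depends on finitely many discrete variables, so arbitrary sets [Y] are allowed. The
    induction needs this generality: it pulls [Y] back through a Bayes update. *)
Lemma belief_measurable t i (Y : set (Theta -> R)) :
  measurable (belief t i @^-1` Y).
Proof.
have [_ ms _ _ _] := signalsP; have [msigma _ _ _ _] := sigmaP.
elim: t i Y => [|t IH] i Y.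
  exact: (measurable_preimage
    [set y | Y (bayes_update nu (fun a => ell a y))] (ms 0%N i)).
have -> : belief t.+1 i @^-1` Y = \bigcup_j \bigcup_y
    (sigma t.+1 i @^-1` [set j] `&` s t.+1 i @^-1` [set y] `&`
     belief t j @^-1` [set mu | Y (bayes_update mu (fun a => ell a y))]).
  apply/seteqP; split => [w Yw|w [j _ [y _ [[/= <- <-]]]]//].
  by exists (sigma t.+1 i w) => //; exists (s t.+1 i w).
apply: fin_bigcup_measurable => // j _; apply: fin_bigcup_measurable => // y _.
by apply: measurableI => //; apply: measurableI; [exact: msigma|exact: ms].
Qed.

Lemma belief_ratio_cvg0 (E : rel 'I_n) (a : Theta) (m : 'I_n) i :
  (forall i j, E j i -> 0 < p i j) -> strongly_connected E ->
  (0 < KL (@ell m th) (@ell m a))%E ->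
  P.-negligible (B `&` ~` [set w |
    Num.sqrt (belief t i w a / belief t i w th) @[t --> \oo] --> (0 : R)]).
Proof.
move=> p_gt0 E_conn /KL_gt0_neq[y ell_y].
pose rho i := bhattacharyya (@ell i th) (@ell i a).
have rho_le1 i' : rho i' <= 1 by exact: bhattacharyya_le1.
have [h [lam [lam_gt0 lam_lt1 h_ge1 h_lam]]] := lyapunov p_stochastic
  (fun i => bhattacharyya_ge0 (@ell i th) (@ell i a)) rho_le1
  p_gt0 E_conn (bhattacharyya_lt1 (ell_pmf m th) (ell_pmf m a) ell_y).
have nu_ge0 b : 0 <= nu b by exact: ltW.
have [p_ge0 _] := p_stochastic.
apply: (@iteration_cvg0 _ _ _ _ _ _ P nu (@ell) p state s sigma th (nu_gt0 th)
  signalsP sigmaP (fun i y => Num.sqrt (ell a y / ell th y))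
  (fun t i w => Num.sqrt (belief t i w a / belief t i w th))
  (Num.sqrt (nu a / nu th)) lam h rho) => //.
- exact: ltW.
- by move=> i'; apply: sum_sqrt_ratio.
- move=> t i' c.
  exact: (belief_measurable t i' [set mu | c <= Num.sqrt (mu a / mu th)]).
- move=> i' w; rewrite belief0_ratio// sqrtrM// divr_ge0//.
- move=> t i' w; rewrite beliefS_ratio// sqrtrM// divr_ge0//; exact: belief_ge0.
Qed.

(** A pathwise argument: for [a != th] the belief in [a] is at most its ratio to the belief in [th],
    as the latter is at most 1. The belief in [th] is the remaining mass. *)
Lemma belief_cvg_delta (w : T) (i : 'I_n) :
  (forall t i, 0 < @ell i th (s t i w)) ->
  (forall a, a != th ->
    Num.sqrt (belief t i w a / belief t i w th) @[t --> \oo] --> (0 : R)) ->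
  forall a, belief t i w a @[t --> \oo] --> ((a == th)%:R : R).
Proof.
move=> ell_w ratio_cvg.
have nu_ge0 b : 0 <= nu b by exact: ltW.
have bel_ge0 t b : 0 <= belief t i w b by exact: belief_ge0.
have bel t := belief_gt0 sigma nu_ge0 ell_ge0 t i (nu_gt0 th) ell_w.
have bel_le1 t : belief t i w th <= 1.
  by rewrite -(bel t).2 (bigD1 th)//= lerDl sumr_ge0.
have off a : a != th -> belief t i w a @[t --> \oo] --> (0 : R).
  move=> /ratio_cvg cvg0.
  apply: (@squeeze_cvgr _ _ _ _ (fun=> 0) (fun t =>
    Num.sqrt (belief t i w a / belief t i w th) *
    Num.sqrt (belief t i w a / belief t i w th))); last 2 first.
  - exact: cvg_cst.
  - by rewrite -[X in _ --> X](mulr0 0); exact: cvgM.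
  apply: nearW => t; rewrite bel_ge0 /= -expr2 sqr_sqrtr ?divr_ge0//.
  by rewrite ler_pdivlMr ?(bel t).1// ler_piMr.
move=> a; have [->|ath] := eqVneq a th; last exact: off.
have -> : (fun t => belief t i w th) =
    (fun t => 1 - \sum_(b | b != th) belief t i w b).
  by apply/funext => t; rewrite -(bel t).2 (bigD1 th)//= addrK.
rewrite -[X in _ --> X]subr0; apply: cvgB; first exact: cvg_cst.
rewrite [X in _ --> X](_ : _ = \sum_(b : Theta | b != th) (0 : R)); last first.
  by rewrite big1.
by apply: (cvg_big add_continuous) => b; exact: off.
Qed.

End Learning.

Theorem theorem1 (R : realType) (d : measure_display) (T : measurableType d)
  (P : probability T R)
  (n : nat) (E : rel 'I_n)
  (Theta : finType) (nu : Theta -> R)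
  (S : 'I_n -> finType) (ell : forall i : 'I_n, Theta -> S i -> R)
  (p : 'M[R]_n)
  (state : T -> Theta) (s : nat -> forall i : 'I_n, T -> S i)
  (sigma : nat -> 'I_n -> T -> 'I_n)
  (nu_pmf : is_pmf nu) (nu_gt0 : forall th, 0 < nu th)
  (ell_pmf : forall i th, is_pmf (ell i th))
  (p_stochastic : row_stochastic p)
  (p_gt0 : forall i j, j \in neighborhood E i -> 0 < p i j)
  (p_eq0 : forall i j, j \notin (neighborhood E i :|: [set i])%SET -> p i j = 0)
  (signalsP : signal_model P nu ell state s)
  (sigmaP : gossip_model P p state s sigma)
  (E_connected : strongly_connected E)
  (th : Theta) (th_identifiable : globally_identifiable ell th) :
  almost_surely_given P (state @^-1` [set th])
    [set w | forall i, belief nu ell s sigma t i w th @[t --> \oo] --> (1 : R)]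
  /\
  almost_surely_given P (state @^-1` [set th])
    [set w | forall i th',
      belief nu ell s sigma t i w th' @[t --> \oo] --> ((th' == th)%:R : R)].
Proof.
have edge_gt0 i j : E j i -> 0 < p i j.
  by move=> Eji; apply: p_gt0; rewrite inE.
pose bel_cvg i th' := [set w |
  belief nu ell s sigma t i w th' @[t --> \oo] --> ((th' == th)%:R : R)].
(* Two null events are discarded: a signal of likelihood 0 under [th] at some time, and a failure of
   some ratio to vanish. Both are countable unions, over time and agents or over agents and
   states. *)
have ell_null : P.-negligible (state @^-1` [set th] `&`
    ~` [set w | forall u : nat * 'I_n, 0 < ell u.2 th (s u.1 u.2 w)]).
  apply: negligible_forall => -[t i] /=.
  apply: (signal_likelihood_gt0 (nu_gt0 th) signalsP sigmaP) => y.
  by have [+ _] := ell_pmf i th; apply.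
have ratio_null : P.-negligible (state @^-1` [set th] `&`
    ~` [set w | forall u : 'I_n * Theta, u.2 != th -> Num.sqrt
      (belief nu ell s sigma t u.1 w u.2 / belief nu ell s sigma t u.1 w th)
        @[t --> \oo] --> (0 : R)]).
  apply: negligible_forall => -[i a] /=.
  have [->|ath] := eqVneq a th.
    by apply: (negligibleS _ (negligible_set0 P)) => w [_ /=]; apply.
  have [m KL_m] := th_identifiable _ ath.
  apply: (negligibleS _ (belief_ratio_cvg0 nu_gt0 signalsP sigmaP ell_pmf
    p_stochastic i edge_gt0 E_connected KL_m)).
  by move=> w [Bw /= nQ]; split => // Qw; apply: nQ.
have bel_null : P.-negligible (state @^-1` [set th] `&`
    ~` [set w | forall i th', bel_cvg i th' w]).
  apply: (negligibleS _ (negligibleU ell_null ratio_null)) => w [Bw /= bel_w].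
  apply: contrapT => /not_orP[/not_andP[//|/contrapT ell_w]].
  move=> /not_andP[//|/contrapT ratio_w]; apply: bel_w => i.
  apply: (belief_cvg_delta nu_gt0 ell_pmf) => [t j|a]; first exact: ell_w (t, j).
  exact: ratio_w (i, a).
(* [almost_surely_given] also asks for a measurable event, which a null complement alone does not
   provide. *)
have m_bel i th' : measurable (bel_cvg i th').
  apply: measurable_cvg_set => t e.
  exact: (belief_measurable signalsP sigmaP t i
    [set mu : Theta -> R | `|(th' == th)%:R - mu th'| < e]).
split; apply: (almost_surely_negligible (nu_gt0 th) signalsP).
- rewrite (_ : [set w | _] = \bigcap_i bel_cvg i th).
    by apply: fin_bigcap_measurable.
  apply/seteqP; split => w bel_w i; have := bel_w i;
    by rewrite /bel_cvg/= eqxx//; apply.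
- apply: (negligibleS _ bel_null) => w [Bw /= bel_w]; split => // bel_w'.
  by apply: bel_w => i; have := bel_w' i th; rewrite /bel_cvg/= eqxx.
- rewrite (_ : [set w | _] = \bigcap_i \bigcap_th' bel_cvg i th').
    by do 2 apply: fin_bigcap_measurable => // ? _.
  apply/seteqP; split => w bel_w i; first by move=> _ th' _; exact: bel_w.
  by move=> th'; exact: bel_w.
- exact: bel_null.
Qed.
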